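(* Let $G$ be a finite nilpotent group having no Sylow subgroup which is generalized quaternion. That is, either $G=G_1$ or $G=G_1\times\mathbb{Z}_n$ with $\gcd(|G_1|,n)=1$, where $G_1$ is a finite nilpotent group having no Sylow subgroups which are generalized quaternion or cyclic. Then: (1) if $G=G_1$, then $\eta(\lambda_1(\mathcal{G}_E(G)))=1$; (2) if $G=G_1\times\mathbb{Z}_n$ and $\gcd(|G_1|,n)=1$, then $\eta(\lambda_1(\mathcal{G}_E(G)))=n$.
   Context: For a group $G$, the enhanced power graph $\mathcal{G}_E(G)$ is the simple graph with vertex set $G$ in which two distinct elements $x,y$ are adjacent if and only if there is $w\in G$ with $x,y\in\langle w\rangle$. For a graph $\Gamma$ on vertices $v_1,\dots,v_N$, the Laplacian matrix $L(\Gamma)$ has diagonal entries $L_{i,i}$ equal to the degree of $v_i$, and for $i\ne j$, $L_{i,j}=-1$ if $v_i,v_j$ are adjacent and $0$ otherwise. $\lambda_1(\Gamma)$ denotes the largest eigenvalue of $L(\Gamma)$ (the Laplacian spectral radius), and $\eta(\lambda_1(\Gamma))$ its multiplicity as an eigenvalue of $L(\Gamma)$. $\mathbb{Z}_n$ is the cyclic group of order $n$, $n$ a positive integer. A generalized quaternion group is a group $Q_{2^k}=\langle x,y : x^{2^{k-1}}=1,\ y^2=x^{2^{k-2}},\ yxy^{-1}=x^{-1}\rangle$ of order $2^k$, $k\ge 3$. ''Sylow subgroups'' means Sylow $p$-subgroups for the primes $p$ dividing the order of the group.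
   Formalization: In part (2) the case of G_1 trivial with n ≥ 2 is excluded: there G = Z_n, the graph is complete on n vertices, and the multiplicity of the largest eigenvalue is n−1 rather than n. *)

(* Defs.v *)
From mathcomp Require Import all_boot all_order all_fingroup all_algebra.
From mathcomp Require Import all_solvable.

Set Implicit Arguments.
Unset Strict Implicit.
Unset Printing Implicit Defensive.

Import Order.TTheory GRing.Theory Num.Theory.

Local Open Scope group_scope.

Definition enhanced_power_adj (gT : finGroupType) (G : {group gT}) : rel gT :=
  fun x y =>
    (x != y) && [exists w in G, (x \in <[w]>) && (y \in <[w]>)].

Definition degree (T : finType) (V : {set T}) (e : rel T) (x : T) : nat :=
  #|[set y in V | e x y]|.

(* The vertices of V are listed by enum_val; the spectrum does not depend on
   the listing. *)
Definition laplacian (R : pzRingType) (T : finType) (V : {set T}) (e : rel T) :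
    'M[R]_#|V| :=
  (\matrix_(i, j)
     if i == j then (degree V e (enum_val i))%:R
     else if e (enum_val i) (enum_val j) then -1 else 0)%R.

Definition largest_eigenvalue (R : rcfType) (N : nat) (A : 'M[R]_N) (a : R) :
    Prop :=
  eigenvalue A a /\ forall b : R, eigenvalue A b -> (b <= a)%R.

(* The largest eigenvalue of A exists and has algebraic multiplicity m; it is
   unique by antisymmetry of the order. *)
Definition largest_eigenvalue_multiplicity (R : rcfType) (N : nat)
    (A : 'M[R]_N) (m : nat) : Prop :=
  exists2 a : R, largest_eigenvalue A a & mup a (char_poly A) = m.

Definition enhanced_power_laplacian (R : rcfType) (gT : finGroupType)
    (G : {group gT}) : 'M[R]_#|G| :=
  laplacian R G (enhanced_power_adj G).

Definition generalized_quaternion (gT : finGroupType) (P : {group gT}) : Prop :=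
  exists2 k : nat, (3 <= k)%N & P \isog 'Q_(2 ^ k).

Definition no_quaternion_Sylow (gT : finGroupType) (G : {group gT}) : Prop :=
  forall (p : nat) (P : {group gT}),
    prime p -> (p %| #|G|)%N -> p.-Sylow(G) P -> ~ generalized_quaternion P.

Definition no_cyclic_Sylow (gT : finGroupType) (G : {group gT}) : Prop :=
  forall (p : nat) (P : {group gT}),
    prime p -> (p %| #|G|)%N -> p.-Sylow(G) P -> ~~ cyclic P.

(* Main.v *)
Require Import Defs.
From mathcomp Require Import all_boot all_order all_fingroup all_algebra.
From mathcomp Require Import all_solvable.
From mathcomp Require Import ring zify.

Set Implicit Arguments.
Unset Strict Implicit.
Unset Printing Implicit Defensive.

Import Order.TTheory GRing.Theory Num.Theory.

Local Open Scope group_scope.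

(** Let N = #|G| and let L be the Laplacian of the enhanced power graph of G.
The Laplacian of any graph on N vertices satisfies, for every vector v,

    v (N - L) v^T = (sum_i v_i)^2 + 1/2 sum_(i, j not adjacent) (v_j - v_i)^2.

The right-hand side is nonnegative, so no eigenvalue of L exceeds N
([laplacian_eigenvalue_le]); it vanishes exactly when the entries of v sum to 0
and v is constant along the edges of the complement graph, so these vectors
form the eigenspace of N ([laplacian_eigenspace_card]).  Suppose that the
vertices adjacent to all others form a set D with 0 < #|D| < N, and that the
complement graph is connected outside D.  Then such a v is determined by its
#|D| arbitrary values on D, the common value outside D being forced by the zero
sum; so N is the largest eigenvalue and its geometric multiplicity is #|D|.  As
L is symmetric, this is also its algebraic multiplicity ([symmetric_mup]).

It remains to see that D may be taken to be C when G = A \x C is nilpotent,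
#|A| and #|C| are coprime, C is cyclic, A is nontrivial and no Sylow subgroup of
A is cyclic or generalized quaternion.  An element a c with a in A, and any
element of C = <[z]>, are both in <[a z]>, because a and z have coprime orders:
every vertex in C is dominating.  For the rest, a p-group with a single subgroup
of order p is cyclic or generalized quaternion.  Hence for each prime p dividing
#|A| there are several subgroups of order p in G, while a cyclic group has only
one: elements of order p that generate different subgroups are not adjacent, and
more generally x is not adjacent to z of order p unless z lies in <[x]>.  This
connects in the complement graph all the x whose order is divisible by p
([nonadj_const_prime]).  Two primes p and q are linked by an element of order
p q, which exists because elements of coprime orders commute in a nilpotent
group.  Finally every element outside C has an order divisible by some prime
divisor of #|A|.

When A is trivial, the hypothesis leaves only the one-vertex graph.  The
decomposition of G itself takes for A the product of the noncyclic Sylow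
subgroups; the product of the cyclic ones is cyclic. *)

(** * Eigenvalue multiplicities of symmetric matrices *)

Local Open Scope ring_scope.

Lemma char_poly_lblock (R : comNzRingType) (r s : nat)
    (A : 'M[R]_r) (B : 'M[R]_(s, r)) (C : 'M[R]_s) :
  char_poly (block_mx A 0 B C) = char_poly A * char_poly C.
Proof.
rewrite /char_poly /char_poly_mx map_block_mx map_mx0 scalar_mx_block.
by rewrite opp_block_mx add_block_mx oppr0 add0r det_lblock.
Qed.

Lemma char_poly_conj (R : fieldType) (n : nat) (P A B : 'M[R]_n) :
  P \in unitmx -> P *m A = B *m P -> char_poly A = char_poly B.
Proof.
move=> uP eqPA; have uP' : map_mx polyC P \in unitmx.
  by rewrite unitmxE det_map_mx rmorph_unit // -unitmxE.
have eqC : map_mx polyC P *m char_poly_mx A = char_poly_mx B *m map_mx polyC P.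
  rewrite /char_poly_mx mulmxBr mulmxBl -!map_mxM /= eqPA.
  by rewrite mul_mx_scalar mul_scalar_mx.
have := congr1 determinant eqC; rewrite !det_mulmx mulrC.
by apply: mulIr; rewrite -unitmxE.
Qed.

Lemma row_base_rank (F : fieldType) (m n r : nat) (K : 'M[F]_(m, n)) :
  \rank K = r -> exists B : 'M[F]_(r, n), (B :=: K)%MS.
Proof. by move=> <-; exists (row_base K); apply: eq_row_base. Qed.

Lemma mulmx_tr_eq0 (R : realDomainType) (n : nat) (v : 'rV[R]_n) :
  v *m v^T = 0 -> v = 0.
Proof.
move=> /matrixP/(_ 0 0); rewrite !mxE => /eqP.
rewrite psumr_eq0 => [/allP v0|i _]; last by rewrite mxE -expr2 sqr_ge0.
apply/rowP=> i; have := v0 i (mem_index_enum i).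
by rewrite !mxE mulf_eq0 orbb => /eqP.
Qed.

(** The kernel of M = A - a and its row space are orthogonal complements, both
stable under A.  In a basis adapted to them A is block diagonal with blocks a
and Q, where a is not an eigenvalue of Q.  The dimension is given as r + s so
that the change of basis has the type of a block matrix. *)
Lemma symmetric_mup_block (R : realFieldType) (r s : nat) (A : 'M[R]_(r + s))
    (a : R) :
  A^T = A -> \rank (eigenspace A a) = r -> mup a (char_poly A) = r.
Proof.
move=> symA rkA; pose M := A - a%:M.
have symM : M^T = M by rewrite /M linearB /= symA tr_scalar_mx.
have [B eqB] := row_base_rank rkA.
have rkM : \rank M = s.
  have := mxrank_ker M; rewrite -/(eigenspace A a) rkA.
  have := rank_leq_row M; lia.
have [W eqW] := row_base_rank rkM.
have BA : B *m A = a *: B by apply/eigenspaceP; rewrite eqB.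
have AM : A *m M = M *m A.
  by rewrite /M mulmxBr mulmxBl mul_mx_scalar mul_scalar_mx.
have stW : (W *m A <= W)%MS.
  have /submxP[X defW] : (W <= M)%MS by rewrite eqW.
  by rewrite eqW [X in X *m A]defW -mulmxA -AM mulmxA submxMl.
have BM0 : B *m M = 0 by apply/sub_kermxP; rewrite eqB.
(* The kernel and the row space of M meet trivially: if u = X M and u M = 0 then
   u u^T = X M u^T = X (u M)^T = 0. *)
have KM0 u : (u <= M)%MS -> u *m M = 0 -> u = 0 :> 'rV_(r + s).
  case/submxP=> X -> XMM; apply: mulmx_tr_eq0.
  by rewrite trmx_mul symM mulmxA XMM mul0mx.
have freeP : col_mx B W \in unitmx.
  rewrite -row_free_unit /row_free -addsmxE mxrank_disjoint_sum.
    by rewrite eqB rkA eqW rkM.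
  apply/row_matrixP=> i; rewrite row0; apply: KM0.
    by rewrite (submx_trans (row_sub _ _)) // -eqW capmxSr.
  apply/sub_kermxP/(submx_trans (row_sub _ _)).
  by rewrite (submx_trans (capmxSl _ _)) // eqB.
have [Q eqQ] := submxP stW.
have eqPA : col_mx B W *m A = block_mx a%:M 0 0 Q *m col_mx B W.
  by rewrite mul_col_mx mul_block_col !mul0mx addr0 add0r mul_scalar_mx BA eqQ.
rewrite (char_poly_conj freeP eqPA) char_poly_lblock mupMl.
  rewrite char_poly_trig ?scalar_mx_is_trig //.
  rewrite (eq_bigr (fun=> 'X - a%:P)) => [|i _]; last by rewrite mxE eqxx.
  by rewrite prodr_const card_ord mup_XsubCX eqxx.
rewrite -eigenvalue_root_char; apply/eigenvalueP=> -[u uQ /eqP[]].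
have freeW : row_free W by rewrite /row_free eqW rkM.
apply: (row_free_inj freeW); rewrite mul0mx; apply: KM0.
  by rewrite -eqW submxMl.
by rewrite mulmxBr -mulmxA eqQ mulmxA uQ mul_mx_scalar -scalemxAl subrr.
Qed.

Lemma symmetric_mup (R : realFieldType) (n : nat) (A : 'M[R]_n) (a : R) :
  A^T = A -> mup a (char_poly A) = \rank (eigenspace A a).
Proof.
move=> symA; have := rank_leq_row (eigenspace A a).
move: {-1}(\rank _) (erefl (\rank (eigenspace A a))) => r rkA le_rn.
have := subnKC le_rn; move: (n - r)%N => s defn {le_rn}.
by case: n / defn A symA rkA => A symA rkA; apply: symmetric_mup_block.
Qed.

(** * The top of the Laplacian spectrum *)

Section LaplacianForm.

Variables (R : rcfType) (T : finType) (V : {set T}) (e : rel T).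
Hypothesis sym_e : symmetric e.

Let N := #|V|.
Let L : 'M[R]_N := laplacian R V e.
Let ev (i : 'I_N) : T := enum_val i.

Lemma laplacian_sym : L^T = L.
Proof.
by apply/matrixP=> i j; rewrite !mxE eq_sym sym_e; case: eqP => // ->.
Qed.

Lemma degree_sum (x : T) :
  (degree V e x)%:R = \sum_(i < N) (e (ev i) x)%:R :> R.
Proof.
rewrite /degree -sum1_card natr_sum -(big_enum_val (fun y => (e y x)%:R)).
rewrite [RHS]big_mkcond [LHS]big_mkcond; apply: eq_bigr => y _.
by rewrite !inE sym_e; case: (y \in V); case: (e y x).
Qed.

Hypothesis irr_e : irreflexive e.

Lemma mul_laplacian (v : 'rV[R]_N) (j : 'I_N) :
  (v *m L) 0 j = \sum_i (e (ev i) (ev j))%:R * (v 0 j - v 0 i).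
Proof.
under [RHS]eq_bigr do rewrite mulrBr.
rewrite sumrB -mulr_suml -degree_sum mxE.
rewrite (bigD1 j) //= [X in _ = _ - X](bigD1 j) //= irr_e mul0r add0r.
rewrite !mxE eqxx mulrC -sumrN; congr (_ + _); apply: eq_bigr => i /negPf nij.
by rewrite mxE nij /ev; case: ifP => _ /=; ring.
Qed.

(** The all-ones matrix plus the Laplacian of the complement graph is N - L; the
diagonal terms i = j of the last sum are zero. *)
Lemma mul_colaplacian (v : 'rV[R]_N) (j : 'I_N) :
  (v *m (N%:R%:M - L)) 0 j =
  \sum_i v 0 i + \sum_i (~~ e (ev i) (ev j))%:R * (v 0 j - v 0 i).
Proof.
rewrite mulmxBr mul_mx_scalar.
have -> (A B : 'rV[R]_N) : (A - B) 0 j = A 0 j - B 0 j by rewrite !mxE.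
rewrite mul_laplacian !mxE -[X in X%:R * _](card_ord N) mulr_natl -sumr_const.
rewrite -big_split -sumrB; apply: eq_bigr => i _ /=.
by case: (e _ _) => /=; ring.
Qed.

(** Each pair of nonadjacent vertices occurs twice in the sum, whence the
factor 2^-1. *)
Lemma colaplacian_form (v : 'rV[R]_N) :
  (v *m (N%:R%:M - L) *m v^T) 0 0 =
  (\sum_i v 0 i) ^+ 2 +
  2^-1 * \sum_j \sum_i (~~ e (ev i) (ev j))%:R * (v 0 j - v 0 i) ^+ 2.
Proof.
rewrite mxE; under eq_bigr do rewrite [v^T _ _]mxE mul_colaplacian mulrDl.
rewrite big_split -mulr_sumr -expr2; congr (_ + _) => /=.
pose c i j : R := (~~ e (ev i) (ev j))%:R.
have cC i j : c i j = c j i by rewrite /c sym_e.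
pose Q := \sum_j \sum_i c i j * (v 0 j - v 0 i) * v 0 j.
(* Exchanging the two summation indices changes the sign of v_j - v_i. *)
have swapQ : Q = - \sum_j \sum_i c i j * (v 0 j - v 0 i) * v 0 i.
  rewrite /Q exchange_big -sumrN; apply: eq_bigr => j _.
  by rewrite -sumrN; apply: eq_bigr => i _; rewrite cC; ring.
transitivity Q; first by apply: eq_bigr => j _; rewrite mulr_suml.
transitivity (2^-1 * (Q + Q)); first by field.
congr (_ * _); rewrite {2}swapQ -sumrB; apply: eq_bigr => j _.
by rewrite -sumrB; apply: eq_bigr => i _; rewrite /c; ring.
Qed.

Lemma colaplacian_psd (v : 'rV[R]_N) : 0 <= (v *m (N%:R%:M - L) *m v^T) 0 0.
Proof.
rewrite colaplacian_form addr_ge0 ?sqr_ge0 // mulr_ge0 ?invr_ge0 ?ler0n //.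
by do 2!apply: sumr_ge0 => ? _; rewrite mulr_ge0 ?ler0n ?sqr_ge0.
Qed.

Lemma laplacian_eigenvalue_le (b : R) : eigenvalue L b -> b <= N%:R.
Proof.
case/eigenvalueP=> v vL nz_v; have := colaplacian_psd v.
rewrite mulmxBr vL mul_mx_scalar -scalerBl -scalemxAl mxE pmulr_lge0.
  by rewrite subr_ge0.
have sq_v : (v *m v^T) 0 0 = \sum_i v 0 i ^+ 2.
  by rewrite mxE; apply: eq_bigr => i _; rewrite mxE expr2.
rewrite lt_def sq_v sumr_ge0 ?andbT => [|i _]; last exact: sqr_ge0.
apply: contraNneq nz_v; rewrite -sq_v => v0; apply/eqP/mulmx_tr_eq0.
by apply/matrixP=> i j; rewrite !ord1 v0 mxE.
Qed.

Lemma laplacian_eigenspace_card (v : 'rV[R]_N) :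
  (v <= eigenspace L N%:R)%MS <->
  \sum_i v 0 i = 0 /\
  forall i j, ~~ e (ev i) (ev j) -> v 0 i = v 0 j.
Proof.
have defK : (v <= eigenspace L N%:R)%MS <-> v *m (N%:R%:M - L) = 0.
  rewrite mulmxBr mul_mx_scalar; split=> [/eigenspaceP-> | /eqP].
    by rewrite subrr.
  by rewrite subr_eq0 => /eqP vL; apply/eigenspaceP.
rewrite defK; split=> [v0 | [sum0 cst]]; last first.
  apply/rowP=> j; rewrite mul_colaplacian sum0 add0r mxE big1 // => i _.
  by case: (boolP (e _ _)) => [|/cst->]; rewrite ?mul0r ?subrr ?mulr0.
have /eqP := colaplacian_form v; rewrite v0 mul0mx mxE eq_sym.
have pos j i : 0 <= (~~ e (ev i) (ev j))%:R * (v 0 j - v 0 i) ^+ 2.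
  by rewrite mulr_ge0 ?ler0n ?sqr_ge0.
rewrite paddr_eq0 ?sqr_ge0 ?mulr_ge0 ?invr_ge0 ?ler0n //; last first.
  by do 2!apply: sumr_ge0 => ? _.
rewrite sqrf_eq0 mulf_eq0 invr_eq0 pnatr_eq0 /= => /andP[/eqP sum0].
rewrite psumr_eq0 => [/allP all0 | j _]; last by apply: sumr_ge0.
split=> // i j ne_ij; have := all0 j (mem_index_enum j).
rewrite /= psumr_eq0 // => /allP/(_ i (mem_index_enum i)).
by rewrite /= ne_ij mul1r sqrf_eq0 subr_eq0 => /eqP.
Qed.

(** Connectedness of the complement graph outside D is expressed by the
functions that are constant along its edges, which is the form the eigenvectors
need.  The conclusion fails for D = V with more than one vertex (a complete
graph), where the zero sum costs one dimension. *)
Lemma laplacian_dominating_multiplicity (D : {set T}) :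
  D \subset V -> (0 < #|D| < N)%N ->
  (forall x y, x \in D -> y \in V -> x != y -> e x y) ->
  (forall f : T -> R,
     (forall x y, x \in V -> y \in V -> ~~ e x y -> f x = f y) ->
     {in V :\: D &, forall x y, f x = f y}) ->
  largest_eigenvalue_multiplicity L #|D|.
Proof.
move=> sDV /andP[D_gt0 D_lt] domD connD.
have [x0 Vx0] : exists x0, x0 \in V by apply/card_gt0P; lia.
pose rk x : 'I_N := enum_rank_in Vx0 x.
have rkK x : x \in V -> ev (rk x) = x by move=> Vx; apply: enum_rankK_in.
have evK i : rk (ev i) = i by apply: enum_valK_in.
have evV i : ev i \in V by apply: enum_valP.
pose m : R := #|V :\: D|%:R.
have m_neq0 : m != 0 by rewrite pnatr_eq0 cardsDS // -/N; lia.
(* The basis vector attached to x in D is 1 at x, 0 elsewhere on D, and the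
   constant outside D that makes the sum zero. *)
pose b x y : R := if y \in D then (y == x)%:R else - m^-1.
pose B : 'M[R]_(#|D|, N) := \matrix_(k, j) b (enum_val k) (ev j).
have sum_b x (F : T -> R) : x \in D ->
    \sum_(y in V) b x y * F y = F x - m^-1 * \sum_(y in V :\: D) F y.
  move=> Dx; rewrite (bigID (mem D)) /=; congr (_ + _).
    rewrite (bigD1 x) /= ?(subsetP sDV) // /b Dx eqxx mul1r big1 ?addr0 // => y.
    by case/andP=> /andP[_ ->] /negPf->; rewrite mul0r.
  rewrite -mulNr mulr_sumr; apply: eq_big => y; first by rewrite inE andbC.
  by case/andP=> _ /negPf nDy; rewrite /b nDy.
have freeB : row_free B.
  apply/row_freeP; exists (\matrix_(j, l) (ev j == enum_val l)%:R).
  apply/matrixP=> k l; rewrite !mxE.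
  under eq_bigr do rewrite !mxE.
  rewrite -(big_enum_val
              (fun y => b (enum_val k) y * (y == enum_val l)%:R)).
  rewrite sum_b ?enum_valP // big1 ?mulr0 ?subr0 => [|y].
    by rewrite (inj_eq enum_val_inj).
  by rewrite inE; case: eqP => // ->; rewrite enum_valP.
have eqB : (B :=: eigenspace L N%:R)%MS.
  apply/eqmxP/andP; split.
    apply/row_subP=> k; apply/laplacian_eigenspace_card; split=> [|i j].
      under eq_bigr do rewrite !mxE -[b _ _]mulr1.
      rewrite -(big_enum_val (fun y => b (enum_val k) y * 1)).
      by rewrite sum_b ?enum_valP // sumr_const mulVf // subrr.
    rewrite !mxE => ne_ij; have [-> // | neq_ij] := eqVneq (ev i) (ev j).
    rewrite /b !ifN //.
      by apply: contra ne_ij => Dj; rewrite sym_e domD // eq_sym.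
    by apply: contra ne_ij => Di; rewrite domD.
  apply/rV_subP=> v /laplacian_eigenspace_card[sum0 cst].
  pose f x : R := v 0 (rk x).
  have cstf : {in V :\: D &, forall x y, f x = f y}.
    by apply: connD => x y Vx Vy ne_xy; apply: cst; rewrite !rkK.
  have sumf : \sum_(x in V) f x = 0.
    rewrite -[RHS]sum0 big_enum_val; apply: eq_bigr => i _.
    by rewrite /f evK.
  suff -> : v = (\row_k f (enum_val k)) *m B by apply: submxMl.
  apply/rowP=> j; rewrite mxE.
  transitivity (\sum_(x in D) f x * b x (ev j)); last first.
    by rewrite big_enum_val; apply: eq_bigr => k _; rewrite !mxE.
  rewrite /b.
  have -> : v 0 j = f (ev j) by rewrite /f evK.
  case: (boolP (ev j \in D)) => [Dj | nDj].
    rewrite (bigD1 (ev j)) //= eqxx mulr1 big1 ?addr0 // => x /andP[_].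
    by rewrite eq_sym => /negPf->; rewrite mulr0.
  rewrite -mulr_suml mulrN; move: sumf; rewrite (bigID (mem D)) /=.
  rewrite (eq_bigl (mem D)) => [|x]; last first.
    by rewrite andb_idl // => /(subsetP sDV).
  move/eqP; rewrite addrC addr_eq0 => /eqP; rewrite -mulNr => <-.
  rewrite (eq_bigr (fun=> f (ev j))) => [|x /andP[Vx nDx]]; last first.
    by apply: cstf; rewrite inE ?nDx ?nDj ?evV.
  rewrite (eq_bigl (mem (V :\: D))); last by move=> x; rewrite !inE andbC.
  by rewrite sumr_const -mulr_natr mulfK.
have rkL : \rank (eigenspace L N%:R) = #|D| by rewrite -eqB; apply/eqP.
exists N%:R; last by rewrite symmetric_mup ?laplacian_sym.
split; last exact: laplacian_eigenvalue_le.
by rewrite /eigenvalue -mxrank_eq0 rkL -lt0n.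
Qed.

End LaplacianForm.

Lemma largest_eigenvalue_multiplicity_dim1 (R : rcfType) (N : nat)
    (A : 'M[R]_N) : N = 1%N -> largest_eigenvalue_multiplicity A 1.
Proof.
move=> N1; subst N.
have charA : char_poly A = 'X - (A 0 0)%:P.
  by rewrite char_poly_trig ?big_ord1 //; apply/is_trig_mxP=> i j; rewrite !ord1.
exists (A 0 0); last by rewrite charA (@mup_XsubCX _ 1) eqxx.
by split=> [|b]; rewrite eigenvalue_root_char charA root_XsubC // => /eqP->.
Qed.

Local Close Scope ring_scope.

(** * Nonadjacency through subgroups of prime order *)

Lemma enhanced_power_adj_sym (gT : finGroupType) (G : {group gT}) :
  symmetric (enhanced_power_adj G).
Proof.
move=> x y; rewrite /enhanced_power_adj eq_sym; congr (_ && _).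
by apply: eq_existsb => w; rewrite [(x \in _) && _]andbC.
Qed.

Lemma enhanced_power_adj_irr (gT : finGroupType) (G : {group gT}) :
  irreflexive (enhanced_power_adj G).
Proof. by move=> x; rewrite /enhanced_power_adj eqxx. Qed.

(** If x and z were in a common <[w]>, then <[u]> and <[z]> would be two
subgroups of the same order of a cyclic group, hence equal. *)
Lemma nonadj_of_order (gT : finGroupType) (G : {group gT}) (x z u : gT) :
  u \in <[x]> -> #[z] = #[u] -> z \notin <[u]> -> ~~ enhanced_power_adj G x z.
Proof.
move=> ux ozu; apply: contraNN => /andP[_ /exists_inP[w _ /andP[xw zw]]].
have uw : u \in <[w]> by rewrite (subsetP _ _ ux) // cycle_subG.
rewrite -cycle_subG (_ : <[z]> = <[u]>) //; apply/eqP.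
by rewrite (eq_subG_cyclic (cycle_cyclic w)) ?cycle_subG //; apply/eqP.
Qed.

(** 'Ohm_1(P) is generated by the elements of order p of P; if all of them were
in <[u]> it would have order p, which characterizes cyclic and generalized
quaternion groups among nontrivial p-groups. *)
Lemma second_prime_order_subgroup (gT : finGroupType) (p : nat)
    (P : {group gT}) (u : gT) :
  p.-group P -> ~~ cyclic P -> ~ generalized_quaternion P -> #[u] = p ->
  exists z, [/\ z \in P, #[z] = p & z \notin <[u]>].
Proof.
move=> pP ncP nqP ou; have ntP : P :!=: 1.
  by apply: contraNneq ncP => ->; apply: cyclic1.
have [p_pr _ _] := pgroup_pdiv pP ntP.
have neq_p : #|'Ohm_1(P)| != p.
  apply: contraNneq ncP => /(prime_Ohm1P pP ntP)/orP[-> //|/andP[_ /eqP]].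
  by move/quaternion_classP.
suff /exists_inP[z Pz /andP[/eqP oz nuz]] :
    [exists z in P, (#[z] == p) && (z \notin <[u]>)] by exists z.
apply: contraNT neq_p => /exists_inPn all_u.
have sOu : 'Ohm_1(P) \subset <[u]>.
  rewrite (OhmE 1 pP) gen_subG; apply/subsetP=> z; rewrite !inE expn1.
  case/andP=> Pz; rewrite -order_dvdn => /(primeP p_pr).2 /orP[|/eqP oz].
    by rewrite order_eq1 => /eqP->; apply: group1.
  by have := all_u z Pz; rewrite oz eqxx /= negbK.
have := cardSg sOu; rewrite -orderE ou => /(primeP p_pr).2 /orP[] //.
by rewrite -trivg_card1 Ohm1_eq1 (negPf ntP).
Qed.

(** * Dominating vertices and connectedness of the complement *)

Section CentralCyclicFactor.

Variables (gT : finGroupType) (G A C : {group gT}).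
Hypotheses (nilG : nilpotent G) (defG : A \x C = G).
Hypotheses (coAC : coprime #|A| #|C|) (cycC : cyclic C).
Hypotheses (noqA : no_quaternion_Sylow A) (nocA : no_cyclic_Sylow A).

Let adj := enhanced_power_adj G.

Lemma cyclic_factor_dominating (x y : gT) :
  x \in C -> y \in G -> x != y -> adj x y.
Proof.
move=> Cx Gy neq_xy; rewrite /adj /enhanced_power_adj neq_xy /=.
have [_ _ cAC _] := dprodP defG.
have [a [c [Aa Cc -> _]]] := mem_dprod defG Gy.
have [z defC] := cyclicP cycC.
have Cz : z \in C by rewrite defC cycle_id.
have caz : commute a z by apply/esym/(centsP cAC).
have coaz : coprime #[a] #[z].
  by rewrite (coprime_dvdl (order_dvdG Aa)) ?(coprime_dvdr (order_dvdG Cz)).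
have Caz : C \subset <[a * z]>.
  rewrite defC caz; apply: cycleMsub; by [apply/esym | rewrite coprime_sym].
have aaz : a \in <[a * z]> by rewrite -cycle_subG cycleMsub.
apply/exists_inP; exists (a * z).
  by have [_ <- _ _] := dprodP defG; apply: mem_mulg.
by rewrite (subsetP Caz) //= groupM // (subsetP Caz).
Qed.

Lemma second_prime_order_subgroup_factor (p : nat) (u : gT) :
  prime p -> p %| #|A| -> #[u] = p ->
  exists z, [/\ z \in G, #[z] = p & z \notin <[u]>].
Proof.
move=> p_pr pA ou; have [P sylP] := Sylow_exists p A.
have [z [Pz oz nuz]] := second_prime_order_subgroup (pHall_pgroup sylP)
  (nocA p_pr pA sylP) (noqA p_pr pA sylP) ou.
exists z; split=> //; have [sAG _] := mulG_sub (dprodW defG).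
by apply: (subsetP sAG); apply: (subsetP (pHall_sub sylP)).
Qed.

(** As a normal Hall subgroup, C contains every element whose order is prime to
#|A|. *)
Lemma outside_factor_prime (x : gT) :
  x \in G -> x \notin C -> exists p, [/\ prime p, p %| #|A| & p %| #[x]].
Proof.
move=> Gx; have hallC : \pi(C).-Hall(G) C.
  by apply: Hall_pi; rewrite -(coprime_sdprod_Hall_r (dprodWsd defG)).
have [_ nCG] := dprod_normal2 defG.
rewrite (mem_normal_Hall hallC nCG Gx) => pi_x.
have /(pdivP)[p p_pr] : 1 < gcdn #[x] #|A|.
  rewrite ltn_neqAle gcdn_gt0 order_gt0 andbT eq_sym.
  apply: contra pi_x => co_x.
  have : #[x] %| #|A| * #|C| by rewrite (dprod_card defG) order_dvdG.
  rewrite Gauss_dvdr // => /pnat_dvd; apply.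
  exact: pgroup_pi.
by rewrite dvdn_gcd => /andP[px pA]; exists p.
Qed.

(* A function constant along the nonadjacent pairs stands for the assignment of
   a connected component of the complement graph. *)
Variables (S : Type) (f : gT -> S).
Hypothesis fP : forall x y, x \in G -> y \in G -> ~~ adj x y -> f x = f y.

(** Let u in <[x]> and t in <[y]> have order p.  If <[u]> and <[t]> differ, then
x, t, u, y is a path in the complement graph; if they are equal, any z of order
p outside <[u]> gives the path x, z, y. *)
Lemma nonadj_const_prime (p : nat) (x y : gT) :
  prime p -> p %| #|A| -> x \in G -> y \in G ->
  p %| #[x] -> p %| #[y] -> f x = f y.
Proof.
move=> p_pr pA Gx Gy px py.
have [u ux ou] := Cauchy p_pr px; have [t ty ot] := Cauchy p_pr py.
have Gsub w z : w \in G -> z \in <[w]> -> z \in G.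
  by rewrite -cycle_subG => /subsetP; apply.
have [Gu Gt] : u \in G /\ t \in G by split; [apply: Gsub ux | apply: Gsub ty].
have [tu | ntu] := boolP (t \in <[u]>).
  have [z [Gz oz nuz]] := second_prime_order_subgroup_factor p_pr pA ou.
  have eq_ut : <[t]> = <[u]>.
    by apply/eqP; rewrite eqEcard cycle_subG tu -!orderE ou ot /=.
  transitivity (f z).
    by apply: fP => //; apply: nonadj_of_order ux _ nuz; rewrite ou.
  apply/esym/fP => //; apply: nonadj_of_order ty _ _; first by rewrite ot.
  by rewrite eq_ut.
have nut : u \notin <[t]>.
  apply: contra ntu => tu.
  have eq_ut : <[u]> = <[t]>.
    by apply/eqP; rewrite eqEcard cycle_subG tu -!orderE ou ot /=.
  by rewrite eq_ut cycle_id.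
transitivity (f t).
  by apply: fP => //; apply: nonadj_of_order ux _ ntu; rewrite ou.
transitivity (f u).
  by apply: fP => //; apply: nonadj_of_order (cycle_id t) _ nut; rewrite ot.
by apply/esym/fP => //; apply: nonadj_of_order ty _ nut; rewrite ot.
Qed.

(** If p divides the order of x and q that of y, an element of order p q has the
same value as both. *)
Lemma nonadj_const_outside : {in G :\: C &, forall x y, f x = f y}.
Proof.
move=> x y /setDP[Gx nCx] /setDP[Gy nCy].
have [p [p_pr pA px]] := outside_factor_prime Gx nCx.
have [q [q_pr qA qy]] := outside_factor_prime Gy nCy.
have [eq_pq | neq_pq] := eqVneq p q.
  by rewrite -eq_pq in qy; apply: (nonadj_const_prime p_pr).
have [sAG _] := mulG_sub (dprodW defG).
have [a Aa oa] := Cauchy p_pr pA; have [b Ab ob] := Cauchy q_pr qA.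
have [Ga Gb] : a \in G /\ b \in G by rewrite !(subsetP sAG).
have co_ab : coprime #[a] #[b] by rewrite oa ob prime_coprime // dvdn_prime2.
have cab : commute a b.
  have cc : <[a]> \subset 'C(<[b]>).
    by apply: (sub_nilpotent_cent2 nilG); rewrite ?cycle_subG // coprime_sym.
  by apply: (centsP cc); apply: cycle_id.
have oab : #[a * b] = (p * q)%N by rewrite orderM // oa ob.
have Gab : a * b \in G by rewrite groupM.
transitivity (f (a * b)).
  by apply: (nonadj_const_prime p_pr) => //; rewrite oab dvdn_mulr.
by apply: (nonadj_const_prime q_pr) => //; rewrite oab dvdn_mull.
Qed.

End CentralCyclicFactor.

(** For A trivial the graph is complete and C is all of G, so the multiplicity
is #|C| only when there is one vertex. *)
Lemma multiplicity_cyclic_factor (R : rcfType) (gT : finGroupType)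
    (G A C : {group gT}) :
  nilpotent G -> A \x C = G -> coprime #|A| #|C| -> cyclic C ->
  no_quaternion_Sylow A -> no_cyclic_Sylow A ->
  #|C| = 1%N \/ A :!=: 1 ->
  largest_eigenvalue_multiplicity (enhanced_power_laplacian R G) #|C|.
Proof.
move=> nilG defG coAC cycC noqA nocA C1orA.
have cardG := dprod_card defG.
have [A1 | ntA] := eqVneq (A : {set gT}) 1.
  case: C1orA => [C1|]; last by rewrite A1 eqxx.
  rewrite C1; apply: largest_eigenvalue_multiplicity_dim1.
  by rewrite -cardG A1 C1 cards1.
have [_ sCG] := mulG_sub (dprodW defG).
apply: laplacian_dominating_multiplicity => //.
- exact: enhanced_power_adj_sym.
- exact: enhanced_power_adj_irr.
- by rewrite cardG_gt0 -cardG -{1}[#|C|]mul1n ltn_pmul2r ?cardG_gt0 ?cardG_gt1.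
- by move=> x y; apply: cyclic_factor_dominating defG coAC cycC _ _.
by move=> f; apply: nonadj_const_outside noqA nocA _ f.
Qed.

(** * Direct decompositions *)

Lemma isog_no_quaternion_Sylow (gT rT : finGroupType) (G : {group gT})
    (H : {group rT}) :
  G \isog H -> no_quaternion_Sylow H -> no_quaternion_Sylow G.
Proof.
case/isogP=> f injf defH; have <- : (f @* G)%G = H by apply: group_inj.
move=> noqH p P p_pr pG sylP [k k3 isoP].
have sPG := pHall_sub sylP.
apply: (noqH p (f @* P)%G p_pr); rewrite ?card_injm ?injm_pHall //.
by exists k => //; apply: isog_trans isoP; rewrite isog_sym sub_isog.
Qed.

Lemma isog_no_cyclic_Sylow (gT rT : finGroupType) (G : {group gT})
    (H : {group rT}) :
  G \isog H -> no_cyclic_Sylow H -> no_cyclic_Sylow G.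
Proof.
case/isogP=> f injf defH; have <- : (f @* G)%G = H by apply: group_inj.
move=> nocH p P p_pr pG sylP.
have sPG := pHall_sub sylP.
rewrite -(injm_cyclic injf sPG).
by apply: (nocH p (f @* P)%G p_pr); rewrite ?card_injm ?injm_pHall.
Qed.

Lemma isog_setX_dprod (gT gT1 gT2 : finGroupType) (G : {group gT})
    (H1 : {group gT1}) (H2 : {group gT2}) :
  G \isog setX H1 H2 ->
  exists A C : {group gT}, [/\ A \x C = G, A \isog H1 & C \isog H2].
Proof.
rewrite isog_sym => /isogP[f injf <-].
have defX := setX_dprod H1 H2.
have [s1 s2] := mulG_sub (dprodW defX).
exists (f @* setX H1 1)%G, (f @* setX 1 H2)%G; split=> /=.
- exact: injm_dprod.
- rewrite isog_sym; apply: isog_trans (isog_setX1 _ H1) _.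
  exact: sub_isog.
- rewrite isog_sym; apply: isog_trans (isog_set1X _ H2) _.
  exact: sub_isog.
Qed.

Lemma cyclic_Zp (n : nat) : cyclic (Zp n).
Proof.
by rewrite /Zp; case: ifP => _; rewrite ?cyclic1 // Zp_cycle cycle_cyclic.
Qed.

(** A is the Hall subgroup for the primes whose Sylow subgroup 'O_p(G) is not
cyclic.  Its complement C is nilpotent with all Sylow subgroups cyclic, hence
cyclic.  The last clause lets properties of the Sylow subgroups of G pass to
A. *)
Lemma noncyclic_Sylow_decomposition (gT : finGroupType) (G : {group gT}) :
  nilpotent G -> exists A C : {group gT},
  [/\ A \x C = G, coprime #|A| #|C|, cyclic C, no_cyclic_Sylow A
    & forall p (P : {group gT}),
        prime p -> p %| #|A| -> p.-Sylow(A) P -> p.-Sylow(G) P].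
Proof.
move=> nilG.
pose pi : nat_pred := [pred p : nat | ~~ cyclic 'O_p(G)].
have hall_pi := nilpotent_pcore_Hall pi nilG.
have hall_pi' := nilpotent_pcore_Hall pi^' nilG.
have mem_pi p : prime p -> p %| #|'O_pi(G)| -> p \in pi.
  move=> p_pr pA; apply: (pnatPpi (pcore_pgroup pi G)).
  by rewrite mem_primes p_pr cardG_gt0.
have sylA p (P : {group gT}) : prime p -> p %| #|'O_pi(G)| ->
    p.-Sylow('O_pi(G)) P -> p.-Sylow(G) P.
  by move=> p_pr pA; apply: subHall_Sylow hall_pi (mem_pi p p_pr pA).
exists 'O_pi(G)%G, 'O_pi^'(G)%G; split => //.
- exact: nilpotent_pcoreC.
- exact: pnat_coprime (pcore_pgroup _ _) (pcore_pgroup _ _).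
- apply: nil_Zgroup_cyclic; last exact: nilpotentS (pcore_sub _ _) nilG.
  apply/forall_inP=> P /SylowP[p p_pr sylP].
  have [-> | ntP] := eqVneq (P : {set gT}) 1; first exact: cyclic1.
  have [_ pP _] := pgroup_pdiv (pHall_pgroup sylP) ntP.
  have pi'p : p \in pi^'.
    apply: (pnatPpi (pcore_pgroup pi^' G)); rewrite mem_primes p_pr cardG_gt0.
    exact: dvdn_trans pP (cardSg (pHall_sub sylP)).
  have sylGP := subHall_Sylow hall_pi' pi'p sylP.
  by rewrite (nilpotent_Hall_pcore nilG sylGP); rewrite inE negbK in pi'p.
- move=> p P p_pr pA sylP.
  rewrite (nilpotent_Hall_pcore nilG (sylA p P p_pr pA sylP)).
  exact: mem_pi p_pr pA.
Qed.

Theorem theorem7p5 (R : rcfType) (gT : finGroupType) (G : {group gT})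
    (nilG : nilpotent G) (noqG : no_quaternion_Sylow G) :
  (exists G1 : {group gT},
     [/\ nilpotent G1, no_quaternion_Sylow G1, no_cyclic_Sylow G1 &
         G :=: G1 \/
         exists n : nat,
           [/\ (0 < n)%N, coprime #|G1| n & G \isog setX G1 (Zp n)]]) /\
  (forall (gT1 : finGroupType) (G1 : {group gT1}),
     nilpotent G1 -> no_quaternion_Sylow G1 -> no_cyclic_Sylow G1 ->
     (G \isog G1 ->
        largest_eigenvalue_multiplicity (enhanced_power_laplacian R G) 1) /\
     (forall n : nat,
        (0 < n)%N -> coprime #|G1| n -> G \isog setX G1 (Zp n) ->
        (* G1 trivial and n > 1 is excluded: then the graph is complete on n
           vertices and the multiplicity is n - 1 *)
        n = 1%N \/ G1 :!=: 1 ->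
        largest_eigenvalue_multiplicity (enhanced_power_laplacian R G) n)).
Proof.
split.
  have [A [C [defG coAC cycC nocA sylA]]] := noncyclic_Sylow_decomposition nilG.
  have [sAG _] := mulG_sub (dprodW defG).
  exists A; split=> //; first exact: nilpotentS nilG.
    move=> p P p_pr pA sylP; apply: (noqG p P p_pr _ (sylA p P p_pr pA sylP)).
    exact: dvdn_trans pA (cardSg sAG).
  right; exists #|C|; split=> //.
  apply: isog_dprod defG (setX_dprod A (Zp_group #|C|)) (isog_setX1 _ A) _.
  apply: isog_trans (isog_set1X _ (Zp_group #|C|)).
  by rewrite isog_cyclic_card // cyclic_Zp card_Zp ?eqxx.
move=> gT1 G1 _ noq1 noc1; split=> [isoG | n n_gt0 co_n isoG n1_or].
  (* The case G = G1 is that of the trivial cyclic factor. *)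
  rewrite -(cards1 (1 : gT)).
  apply: (@multiplicity_cyclic_factor R _ G G 1%G) => //.
  - exact: dprodg1.
  - by rewrite cards1 coprimen1.
  - exact: cyclic1.
  - exact: isog_no_cyclic_Sylow isoG noc1.
  by left; apply: cards1.
have [A [C [defG isoA isoC]]] := isog_setX_dprod isoG.
have cardC : #|C| = n by rewrite (card_isog isoC) card_Zp.
have cardA := card_isog isoA.
rewrite -cardC; apply: (multiplicity_cyclic_factor R nilG defG).
- by rewrite cardA cardC.
- by rewrite (isog_cyclic isoC) cyclic_Zp.
- exact: isog_no_quaternion_Sylow isoA noq1.
- exact: isog_no_cyclic_Sylow isoA noc1.
by rewrite cardC -cardG_gt1 cardA cardG_gt1.
Qed.
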